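(* Let $T\ge 2$ be an integer and let $p:\mathbb{Z}[0,T+1]\to\mathbb{R}$ be a map with $p^->1$ and $p^+>1$, where $p^-:=\min_{k\in\mathbb{Z}[0,T+1]}p(k)$ and $p^+:=\max_{k\in\mathbb{Z}[0,T+1]}p(k)$. Let $g:\mathbb{R}\to\mathbb{R}$ be a nonnegative and continuous function. Assume that $$\liminf_{t\to 0^+}\frac{\int_0^t g(s)\,ds}{t^{p^+}}=0\qquad\text{and}\qquad \limsup_{t\to 0^+}\frac{\int_0^t g(s)\,ds}{t^{p^-}}=+\infty .$$ Then, for each $\lambda>0$, the problem $$\begin{cases}-\Delta\big(|\Delta u(k-1)|^{p(k-1)-2}\Delta u(k-1)\big)=\lambda\, g(u(k)), & k\in\mathbb{Z}[1,T],\\ u(0)=u(T+1)=0,\end{cases}$$ admits a sequence of nonzero solutions which converges to zero.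
   Context: For integers $a<b$, $\mathbb{Z}[a,b]:=\{a,a+1,\dots,b\}$. The forward difference operator is $\Delta u(k-1):=u(k)-u(k-1)$; the left-hand side of the equation is $-\Delta(w(k-1))=-(w(k)-w(k-1))$ with $w(k-1)=|\Delta u(k-1)|^{p(k-1)-2}\Delta u(k-1)$, where $|s|^{q-2}s$ is read as $0$ at $s=0$. A solution is a function $u:\mathbb{Z}[0,T+1]\to\mathbb{R}$ satisfying the equation for every $k\in\mathbb{Z}[1,T]$ and the boundary conditions. Solutions lie in the finite-dimensional space $H=\{u:\mathbb{Z}[0,T+1]\to\mathbb{R}:\ u(0)=u(T+1)=0\}$ with norm $\|u\|=\big(\sum_{k=1}^{T+1}|\Delta u(k-1)|^2\big)^{1/2}$; convergence to zero is convergence to the zero function in this norm (equivalently in any norm on $H$). *)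

(* Defs.v *)
From HB Require Import structures.
From mathcomp Require Import all_boot all_order all_algebra.
From mathcomp Require Import all_classical all_reals all_analysis.

Set Implicit Arguments.
Unset Strict Implicit.
Unset Printing Implicit Defensive.

Import Order.TTheory GRing.Theory Num.Theory.
Import numFieldNormedType.Exports.

Local Open Scope ring_scope.

(* A function on Z[0,n] is a function on 'I_n.+1. For k : 'I_n,
   [widen_ord (leqnSn n) k] and [lift ord0 k] have values k and k + 1. *)
Definition fwd_diff (V : zmodType) (n : nat) (u : 'I_n.+1 -> V) (k : 'I_n) : V :=
  u (lift ord0 k) - u (widen_ord (leqnSn n) k).

(* |s|^(q-2) s; the factor s makes it 0 at s = 0 whatever the value of
   the power there. *)
Definition phi_q (R : realType) (q s : R) : R := (`|s| `^ (q - 2)) * s.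

(* w(k) = |Delta u(k)|^(p(k)-2) Delta u(k), for k in Z[0,T]. *)
Definition px_flux (R : realType) (T : nat) (p u : 'I_T.+2 -> R)
    (k : 'I_T.+1) : R :=
  phi_q (p (widen_ord (leqnSn T.+1) k)) (fwd_diff u k).

(* The interior nodes k in Z[1,T] are indexed by j = k - 1 : 'I_T. *)
Definition interior_node (T : nat) (j : 'I_T) : 'I_T.+2 :=
  widen_ord (leqnSn T.+1) (lift ord0 j).

Definition is_solution (R : realType) (T : nat) (p : 'I_T.+2 -> R)
    (g : R -> R) (lambda : R) (u : 'I_T.+2 -> R) : Prop :=
  [/\ forall j : 'I_T, - fwd_diff (px_flux p u) j = lambda * g (u (interior_node j)),
      u ord0 = 0 & u ord_max = 0].

Definition Hnorm (R : realType) (T : nat) (u : 'I_T.+2 -> R) : R :=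
  Num.sqrt (\sum_(k < T.+1) `|fwd_diff u k| ^+ 2).

(* Starting from the value p ord0 is harmless, as it is itself among the
   values over which the extremum is taken. *)
Definition pmin (R : realType) (T : nat) (p : 'I_T.+2 -> R) : R :=
  \big[Num.min/p ord0]_(k < T.+2) p k.

Definition pmax (R : realType) (T : nat) (p : 'I_T.+2 -> R) : R :=
  \big[Num.max/p ord0]_(k < T.+2) p k.

Definition primitive0 (R : realType) (g : R -> R) (t : R) : R :=
  \int[lebesgue_measure]_(s in `[0, t]%classic) g s.

(* Main.v *)
(* Fix a primitive F of g near 0 with F(0) = 0. Solutions are critical points
   of J(u) = sum |Delta u|^p / p - lambda sum F(u), minimised over the compact
   set of u vanishing at the end points with |Delta u| <= rho for every k.
   If |Delta u| = rho for some k, then J(u) > 0 as soon as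
   F((T+1) rho) / rho^(p+) is small, which by the liminf condition holds for
   arbitrarily small rho. A function equal to a constant t on the interior
   nodes has J < 0 for suitable t <= rho by the limsup condition. The minimiser
   is therefore nonzero and satisfies all constraints strictly, so varying one
   interior value at a time gives the equation; its norm is at most
   (T+1) rho. *)
Require Import Defs.
From HB Require Import structures.
From mathcomp Require Import all_boot all_order all_algebra.
From mathcomp Require Import all_classical all_reals all_analysis.
From mathcomp Require Import ring.

Set Implicit Arguments.
Unset Strict Implicit.
Unset Printing Implicit Defensive.

Import Order.TTheory GRing.Theory Num.Theory.
Import numFieldNormedType.Exports.

Local Open Scope classical_set_scope.
Local Open Scope ring_scope.

(** * Derivative of |s|^q / q, and a primitive of g around 0 *)

(** Away from 0 this is the power rule, reflected through [-%R] on the negative side. At 0 the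
    difference quotient has size |h|^(q-1) / q, which tends to 0 because [1 < q]. *)
Lemma is_derive_normr_powR (R : realType) (q x : R) : 1 < q ->
  is_derive x 1 (fun s : R => `|s| `^ q / q) (phi_q q x).
Proof.
move=> q1; have q0 : q != 0 by rewrite gt_eqF// (lt_trans _ q1).
have dpow (s : R) : 0 < s -> is_derive s 1 (fun t : R => t `^ q / q) (s `^ (q - 1)).
  move=> s0; have -> : (fun t : R => t `^ q / q) = q^-1 \*: (fun t : R => t `^ q).
    by apply/funext => t /=; rewrite mulrC.
  have -> : s `^ (q - 1) = q^-1 *: (q * s `^ (q - 1)).
    by rewrite /GRing.scale/= mulKf.
  by apply: is_deriveZ; exact: is_derive1_powR.
have powE (s : R) : 0 < s -> s `^ (q - 2) * s = s `^ (q - 1).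
  move=> s0; rewrite (_ : q - 1 = q - 2 + 1); last by ring.
  by rewrite (@powRD _ s (q - 2) 1) ?(gt_eqF s0) ?implybT// powRr1// ltW.
have [x0|x0|->] := ltgtP x 0.
- rewrite /phi_q ltr0_norm// -[X in _ * X]opprK mulrN powE ?oppr_gt0//.
  apply: (@near_eq_is_derive _ _ _ ((fun t : R => t `^ q / q) \o -%R)).
    by near=> s; rewrite /= ltr0_norm//; near: s; exact: lt_nbhsl.
  rewrite -mulrN1; apply: is_derive1_comp.
  by apply: dpow; rewrite oppr_gt0.
- rewrite /phi_q gtr0_norm// powE//.
  apply: (@near_eq_is_derive _ _ _ (fun t : R => t `^ q / q)); last exact: dpow.
  by near=> s; rewrite gtr0_norm//; near: s; exact: lt_nbhsr.
- have d0 : (fun h : R => h^-1 *: (((fun s : R => `|s| `^ q / q) \o shift 0) (h *: 1)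
       - `|0 : R| `^ q / q)) @ 0^' --> (0 : R).
    apply/cvgr0Pnorm_lt => e e0; near=> h.
    have h0 : h != 0 by near: h; exact: nbhs_dnbhs_neq.
    have hp : 0 < `|h| by rewrite normr_gt0.
    have he : `|h| < e `^ (q - 1)^-1.
      by near: h; apply: dnbhs0_lt; rewrite powR_gt0.
    rewrite /= /GRing.scale/= mulr1 addr0 normr0 powR0// mul0r subr0.
    rewrite normrM normfV ger0_norm; last first.
      by rewrite divr_ge0 ?powR_ge0// (le_trans _ (ltW q1)).
    rewrite -mulr_powRB1 ?(lt_trans _ q1)// -mulrA mulKf ?gt_eqF//.
    rewrite (@le_lt_trans _ _ (`|h| `^ (q - 1)))//.
      by rewrite ler_pdivrMr ?(lt_trans _ q1)// ler_peMr ?powR_ge0// ltW.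
    have -> : e = (e `^ (q - 1)^-1) `^ (q - 1).
      by rewrite -powRrM mulVf ?powRr1 ?ltW// subr_eq0 gt_eqF.
    by apply: gt0_ltr_powR; rewrite ?nnegrE ?powR_ge0// subr_gt0.
  rewrite /phi_q mulr0; split; first by apply/cvg_ex; exists 0.
  exact/cvg_lim.
Unshelve. all: end_near. Qed.

(** [primitive0 g] is 0 at negative arguments, where the interval is empty, so it need not be a
    primitive of [g] to the left of 0. Integrating from -1 and subtracting the value at 0 gives one
    on both sides. *)
Lemma ge0_local_primitive (R : realType) (g : R -> R) :
  (forall x, 0 <= g x) -> continuous g ->
  exists F : R -> R,
    [/\ forall x : R, -1 < x < 1 -> is_derive x 1 F (g x),
        forall x y : R, -1 < x -> x <= y -> y < 1 -> F x <= F y &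
        forall x : R, 0 <= x < 1 -> F x = primitive0 g x].
Proof.
move=> g0 cg.
have ig (a b : R) : lebesgue_measure.-integrable `[a, b] (EFin \o g).
  by apply: continuous_compact_integrable;
    [exact: segment_compact|exact: continuous_subspaceT].
pose I (x : R) := \int[lebesgue_measure]_(t in `[-1, x]) g t.
have IB (x y : R) : -1 <= x -> x <= y ->
    I y - I x = \int[lebesgue_measure]_(t in `]x, y]) g t.
  by move=> x1 xy; rewrite /I (Rintegral_itvB (ig _ _)) ?bnd_simp.
have N10 : (-1 : R) <= 0 by rewrite lerN10.
exists (fun x => I x - I 0); split.
- move=> x /andP[x1 x2].
  have [dI I'] := continuous_FTC1_closed x2 (ig _ _) x1 (cg x).
  rewrite -[g x]subr0; apply: is_deriveB.
  by apply: DeriveDef => //; rewrite -derive1E.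
- move=> x y x1 xy _; rewrite lerD2r -subr_ge0 IB ?(ltW x1)//.
  exact: Rintegral_ge0.
- move=> x /andP[x0 _]; rewrite IB// /primitive0 -Rintegral_itv_obnd_cbnd//.
  apply: integrableS (ig 0 x) => //; exact: subset_itv_oc_cc.
Qed.

(** * The energy functional and its derivative along lines *)

(** The second sum includes the two end nodes; they contribute nothing when [F 0 = 0] and the
    boundary conditions hold. *)
Definition energy (R : realType) (T : nat) (p : 'I_T.+2 -> R) (F : R -> R)
    (lambda : R) (u : 'I_T.+2 -> R) : R :=
  \sum_(k < T.+1) `|fwd_diff u k| `^ p (widen_ord (leqnSn T.+1) k)
                  / p (widen_ord (leqnSn T.+1) k)
  - lambda * \sum_i F (u i).

Lemma fwd_diffD (V : zmodType) (n : nat) (u v : 'I_n.+1 -> V) k :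
  fwd_diff (fun i => u i + v i) k = fwd_diff u k + fwd_diff v k.
Proof. by rewrite /fwd_diff opprD addrACA. Qed.

Lemma fwd_diffZ (R : pzRingType) (n : nat) (a : R) (u : 'I_n.+1 -> R) k :
  fwd_diff (fun i => a * u i) k = a * fwd_diff u k.
Proof. by rewrite /fwd_diff mulrBr. Qed.

Lemma is_derive_energy (R : realType) (T : nat) (p : 'I_T.+2 -> R)
    (F g : R -> R) (lambda : R) (v h : 'I_T.+2 -> R) (t : R) :
  (forall i, 1 < p i) ->
  (forall i, is_derive (v i + t * h i) 1 F (g (v i + t * h i))) ->
  is_derive t 1 (fun s => energy p F lambda (fun i => v i + s * h i))
    (\sum_(k < T.+1) px_flux p (fun i => v i + t * h i) k * fwd_diff h k
     - lambda * \sum_i g (v i + t * h i) * h i).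
Proof.
move=> p1 dF.
have dline (a b : R) : is_derive t 1 (fun s : R => a + s * b) b.
  by apply: is_derive_eq; rewrite add0r scaler0 add0r mul1r /GRing.scale/= mulr1.
pose A (k : 'I_T.+1) (s : R) := `|fwd_diff (fun i => v i + s * h i) k|
  `^ p (widen_ord (leqnSn T.+1) k) / p (widen_ord (leqnSn T.+1) k).
pose B (i : 'I_T.+2) (s : R) := F (v i + s * h i).
have -> : (fun s => energy p F lambda (fun i => v i + s * h i)) =
    \sum_(k < T.+1) A k - lambda \*: \sum_(i < T.+2) B i.
  by apply/funext => s; rewrite !fctE !fct_sumE.
apply: is_deriveB; apply: is_derive_sum => k.
rewrite (_ : A k = (fun s : R => `|s| `^ p (widen_ord (leqnSn T.+1) k)
    / p (widen_ord (leqnSn T.+1) k)) \o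
    (fun s => fwd_diff v k + s * fwd_diff h k)); last first.
  by apply/funext => s; rewrite /A /= fwd_diffD fwd_diffZ.
apply: is_derive1_comp.
rewrite /px_flux fwd_diffD fwd_diffZ.
exact: is_derive_normr_powR.
Qed.

(** * Unit bumps, and bounds deduced from the differences *)

(** A bump at node j + 1 rises across edge j and falls across edge j + 1. This replaces summation by
    parts. *)
Lemma fwd_diff_interior_node (R : pzRingType) (T : nat) (j : 'I_T) (k : 'I_T.+1) :
  fwd_diff (fun i => (i == interior_node j)%:R : R) k =
  (k == widen_ord (leqnSn T) j)%:R - (k == lift ord0 j)%:R.
Proof.
by rewrite /fwd_diff /interior_node -!val_eqE /= /bump /= !add1n eqSS.
Qed.

Lemma sum_mul_eq_op (R : pzRingType) (I : finType) (f : I -> R) (i0 : I) :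
  \sum_i f i * (i == i0)%:R = f i0.
Proof.
rewrite (bigD1 i0)//= eqxx mulr1 big1 ?addr0// => i /negbTE ->.
by rewrite mulr0.
Qed.

Lemma ler_norm_fwd_diff (R : realType) (n : nat) (u : 'I_n.+1 -> R) (rho : R) :
  u ord0 = 0 -> (forall k, `|fwd_diff u k| <= rho) ->
  forall i, `|u i| <= rho *+ i.
Proof.
move=> u0 ud [m]; elim: m => [|m IH] lmn.
  by rewrite (_ : Ordinal lmn = ord0) ?u0 ?normr0//; exact: val_inj.
have lmn' : (m < n)%N by [].
have := ud (Ordinal lmn').
rewrite /fwd_diff (_ : lift ord0 _ = Ordinal lmn); last exact: val_inj.
set w := widen_ord _ _; have -> : w = Ordinal (leqW lmn' : m < n.+1)%N.
  exact: val_inj.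
move=> d; rewrite mulrS -(subrK (u (Ordinal (leqW lmn' : m < n.+1)%N)) (u _)).
by rewrite (le_trans (ler_normD _ _))// lerD// IH.
Qed.

Lemma Hnorm_le (R : realType) (T : nat) (u : 'I_T.+2 -> R) (rho : R) :
  0 <= rho -> (forall k, `|fwd_diff u k| <= rho) -> Hnorm u <= rho *+ T.+1.
Proof.
move=> r0 ud; rewrite -[leRHS]ger0_norm ?mulrn_wge0// -sqrtr_sqr ler_wsqrtr//.
apply: (@le_trans _ _ (\sum_(k < T.+1) rho ^+ 2)).
  by apply: ler_sum => k _; rewrite ler_pXn2r ?nnegrE// ud.
rewrite sumr_const card_ord exprMn_n -!(mulr_natr (rho ^+ 2)).
(* The crude bound T + 1 <= (T + 1)^2 avoids a square root in the statement. *)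
by rewrite ler_wpM2l ?sqr_ge0// ler_nat expnS expn1 leq_pmulr.
Qed.

Lemma pmin_le (R : realType) (T : nat) (p : 'I_T.+2 -> R) i : pmin p <= p i.
Proof. exact: bigmin_le. Qed.

Lemma le_pmax (R : realType) (T : nat) (p : 'I_T.+2 -> R) i : p i <= pmax p.
Proof. exact: le_bigmax. Qed.

(** * Minimality in each interior coordinate gives the equation *)

Lemma critical_is_solution (R : realType) (T : nat) (p : 'I_T.+2 -> R)
    (F g : R -> R) (lambda delta : R) (v : 'I_T.+2 -> R) :
  (forall i, 1 < p i) -> 0 < delta ->
  v ord0 = 0 -> v ord_max = 0 ->
  (forall i (t : R), `|t| < delta -> is_derive (v i + t) 1 F (g (v i + t))) ->
  (forall (j : 'I_T) (t : R), `|t| < delta -> energy p F lambda v <=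
     energy p F lambda (fun i => v i + t * (i == interior_node j)%:R)) ->
  is_solution p g lambda v.
Proof.
move=> p1 d0 v0 vT dF min_v; split => // j.
pose h (i : 'I_T.+2) : R := (i == interior_node j)%:R.
pose f t := energy p F lambda (fun i => v i + t * h i).
have normh (t : R) i : `|t| < delta -> `|t * h i| < delta.
  by move=> td; rewrite /h; case: eqP; rewrite ?mulr1// mulr0 normr0.
have itvE (t : R) : t \in `](- delta), delta[ -> `|t| < delta.
  by rewrite in_itv/= ltr_norml.
have df (t : R) (td : `|t| < delta) := is_derive_energy lambda p1
  (fun i => dF i _ (normh t i td)).
have v0E : (fun i => v i + 0 * h i) = v.
  by apply/funext => i; rewrite mul0r addr0.
(* Fermat's rule: [f] has an interior minimum at 0 on the interval of radius [delta]. *)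
have f'0 : is_derive (0 : R) 1 f 0.
  apply: (@derive1_at_min _ f (- delta) delta).
  - by rewrite ge0_cp// ltW.
  - by move=> t /itvE /df ?; apply: ex_derive.
  - by rewrite in_itv/= oppr_lt0 d0.
  - by move=> t /itvE td; rewrite /f v0E min_v.
have d0' : `|0 : R| < delta by rewrite normr0.
have := df 0 d0'; rewrite v0E => df0.
have := @derive_val _ _ _ _ _ _ _ f'0; rewrite (@derive_val _ _ _ _ _ _ _ df0).
(* Only the two edges adjacent to the varied node survive. *)
have S1 : \sum_k px_flux p v k * fwd_diff h k = - fwd_diff (px_flux p v) j.
  under eq_bigr do rewrite fwd_diff_interior_node mulrBr.
  by rewrite big_split/= sumrN !sum_mul_eq_op /fwd_diff opprB.
have S2 : \sum_i g (v i + 0 * h i) * h i = g (v (interior_node j)).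
  by under eq_bigr do rewrite mul0r addr0; rewrite sum_mul_eq_op.
by move=> E; apply/eqP; rewrite -subr_eq0 -S1 -S2; exact/eqP.
Qed.

(** * Sign of the energy on the boundary of the constraint set and at a plateau *)

(** Telescoping bounds every |u(i)| by (T+1) rho, so monotonicity of [F] bounds the potential sum.
    The saturated edge [k0] alone outweighs it, the other edges contributing nonnegative terms. *)
Lemma energy_boundary_gt0 (R : realType) (T : nat) (p : 'I_T.+2 -> R)
    (F : R -> R) (lambda rho : R) (u : 'I_T.+2 -> R) (k0 : 'I_T.+1) :
  (forall i, 1 < p i) -> 0 < lambda -> 0 < rho -> rho *+ T.+1 < 1 ->
  (forall x y : R, -1 < x -> x <= y -> y < 1 -> F x <= F y) ->
  lambda * (F (rho *+ T.+1) *+ T.+2) < rho `^ pmax p / pmax p ->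
  u ord0 = 0 -> (forall k, `|fwd_diff u k| <= rho) -> `|fwd_diff u k0| = rho ->
  0 < energy p F lambda u.
Proof.
move=> p1 l0 r0 c1 mF Fc u0 ud uk0.
have p0 i : 0 < p i := lt_trans ltr01 (p1 i).
have r1 : rho <= 1.
  by rewrite (le_trans _ (ltW c1))// -[leLHS]mulr1n ler_wpMn2l// ltW.
rewrite /energy subr_gt0.
apply: (@le_lt_trans _ _ (lambda * (F (rho *+ T.+1) *+ T.+2))).
  rewrite ler_pM2l// -[X in _ *+ X](card_ord T.+2) -sumr_const.
  apply: ler_sum => i _.
  have : `|u i| <= rho *+ T.+1.
    rewrite (le_trans (ler_norm_fwd_diff u0 ud i))// ler_wpMn2l ?ltW//.
    by rewrite -ltnS ltn_ord.
  rewrite ler_norml => /andP[ui1 ui2]; apply: mF => //.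
  by rewrite (lt_le_trans _ ui1)// ltrN2.
apply: (lt_le_trans Fc); rewrite (bigD1 k0)//= uk0.
rewrite -[leLHS]addr0 lerD//; last first.
  by apply: sumr_ge0 => k _; rewrite divr_ge0 ?powR_ge0// ltW.
(* As rho <= 1, the larger exponent gives the smaller power, and dividing by the larger exponent
   decreases it further. *)
set q := p _; have qP : q <= pmax p := le_pmax p _.
have P0 : 0 < pmax p := lt_le_trans (p0 _) qP.
apply: ler_pM; rewrite ?powR_ge0 ?invr_ge0 ?(ltW P0)//.
  by apply: ger_powR => //; rewrite r0.
by rewrite lef_pV2 ?posrE// p0.
Qed.

Lemma energy_plateau_lt0 (R : realType) (T : nat) (p : 'I_T.+2 -> R)
    (F : R -> R) (lambda t : R) :
  (0 < T)%N -> (forall i, 1 < p i) -> 0 < lambda -> 0 < t <= 1 ->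
  F 0 = 0 -> t `^ pmin p *+ T.+1 < lambda * F t ->
  energy p F lambda
    (fun i => if (i == ord0) || (i == ord_max) then 0 else t) < 0.
Proof.
move=> T0 p1 l0 /andP[t0 t1] F0 Ft.
have Ft0 : 0 < F t.
  by rewrite -(pmulr_rgt0 _ l0) (le_lt_trans _ Ft)// mulrn_wge0// powR_ge0.
rewrite /energy subr_lt0; apply: (@le_lt_trans _ _ (t `^ pmin p *+ T.+1)).
  rewrite -[X in _ *+ X](card_ord T.+1) -sumr_const.
  apply: ler_sum => k _; set q := p _.
  have q1 : 1 < q := p1 _.
  rewrite ler_pdivrMr ?(lt_trans _ q1)//.
  apply: (@le_trans _ _ (t `^ pmin p)); last by rewrite ler_peMr ?powR_ge0 ?ltW.
  apply: (@le_trans _ _ (t `^ q)); last first.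
    by apply: ger_powR (pmin_le p _); rewrite t0.
  apply: ge0_ler_powR; rewrite ?nnegrE ?(ltW t0) ?(le_trans _ (ltW q1))//.
  rewrite /fwd_diff; do 2 case: ifP => _;
    by rewrite ?subr0 ?sub0r ?subrr ?normrN ?normr0 ?(ltW t0) ?(gtr0_norm t0).
apply: (lt_le_trans Ft); rewrite ler_pM2l//.
(* Node 1 is interior because [0 < T]; the remaining values of [F] are 0 or [F t], hence
   nonnegative. *)
pose i1 : 'I_T.+2 := inord 1.
rewrite (bigD1 i1)//= ifF; last first.
  by rewrite -!val_eqE /= inordK//= eqSS eq_sym gtn_eqF.
rewrite -[leLHS]addr0 lerD// sumr_ge0// => i _.
by case: ifP => _; rewrite ?F0// ltW.
Qed.

(** * Continuity and compactness, for functions encoded as row vectors *)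

Lemma continuous_fwd_diff (R : realType) (n : nat) (k : 'I_n) :
  continuous (fun w : 'rV[R]_n.+1 => fwd_diff (w ord0) k).
Proof.
move=> v.
exact: cvgB (@coord_continuous R 1 n.+1 ord0 _ v)
  (@coord_continuous R 1 n.+1 ord0 _ v).
Qed.

Lemma continuous_energy (R : realType) (T : nat) (p : 'I_T.+2 -> R)
    (F : R -> R) (lambda : R) (v : 'rV[R]_T.+2) :
  (forall i, 1 < p i) -> (forall i, {for v ord0 i, continuous F}) ->
  {for v, continuous (fun w : 'rV[R]_T.+2 => energy p F lambda (w ord0))}.
Proof.
move=> p1 cF.
have cvg_sum n (f : 'I_n -> 'rV[R]_T.+2 -> R) :
    (forall k, {for v, continuous (f k)}) ->
    {for v, continuous (fun w => \sum_k f k w)}.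
  move=> cf; have addc : continuous (fun x : R * R => x.1 + x.2).
    by move=> x; apply: cvgD; [exact: cvg_fst|exact: cvg_snd].
  exact: (@cvg_big R 'I_n +%R 0 xpredT addc _ (nbhs v)
    (index_enum 'I_n) f (fun k => f k v) _ (fun k _ => cf k)).
have flux_cvg : {for v, continuous (fun w : 'rV[R]_T.+2 => \sum_(k < T.+1)
    `|fwd_diff (w ord0) k| `^ p (widen_ord (leqnSn T.+1) k)
    / p (widen_ord (leqnSn T.+1) k))}.
  apply: cvg_sum => k.
  apply: (@continuous_comp _ _ _ (fun w : 'rV[R]_T.+2 => fwd_diff (w ord0) k)
    (fun s : R => `|s| `^ p (widen_ord (leqnSn T.+1) k)
                  / p (widen_ord (leqnSn T.+1) k))).
    exact: continuous_fwd_diff.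
  apply/differentiable_continuous/derivable1_diffP.
  by apply: ex_derive; exact: is_derive_normr_powR.
have F_cvg : {for v, continuous (fun w : 'rV[R]_T.+2 => \sum_i F (w ord0 i))}.
  apply: cvg_sum => i.
  apply: (@continuous_comp _ _ _ (fun w : 'rV[R]_T.+2 => w ord0 i) F) => //.
  exact: coord_continuous.
exact: cvgB flux_cvg (cvgMl_tmp F_cvg).
Qed.

(** The constraints are closed, and telescoping from the left end confines the set to a compact
    box. *)
Lemma compact_fwd_diff_le (R : realType) (T : nat) (rho : R) :
  compact [set v : 'rV[R]_T.+2 | [/\ v ord0 ord0 = 0, v ord0 ord_max = 0 &
    forall k, `|fwd_diff (v ord0) k| <= rho]].
Proof.
set K := (X in compact X).
have closed_pre (f : 'rV[R]_T.+2 -> R) (D : set R) :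
    continuous f -> closed D -> closed [set v | D (f v)].
  by move=> /continuous_closedP; exact.
pose B : set 'rV[R]_T.+2 :=
  [set v | forall i, `[- (rho *+ T.+2), rho *+ T.+2]%classic (v ord0 i)].
have cB : compact B.
  apply: (@rV_compact _ _ (fun=> `[- (rho *+ T.+2), rho *+ T.+2]%classic)) => _.
  exact: segment_compact.
apply: (subclosed_compact _ cB) => [|v [v0 _ vd] i /=].
  rewrite (_ : K =
    [set v | v ord0 ord0 = 0] `&` [set v | v ord0 ord_max = 0] `&`
    \bigcap_k [set v | `|fwd_diff (v ord0) k| <= rho]); last first.
    apply/seteqP; split=> [v [v0 vT vd]|v [[v0 vT] vd]].
      by split=> [//|k _]; exact: vd.
    by split => // k; exact: vd.
  apply: closedI; [apply: closedI|].
  - apply: (closed_pre (fun v => v ord0 ord0) [set x | x = 0]) => //.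
    exact: coord_continuous.
  - apply: (closed_pre (fun v => v ord0 ord_max) [set x | x = 0]) => //.
    exact: coord_continuous.
  - apply: closed_bigI => k _.
    apply: (closed_pre (fun v => `|fwd_diff (v ord0) k|) [set x | x <= rho]) => //.
    by move=> v; exact: (cvg_norm (@continuous_fwd_diff R T.+1 k v)).
rewrite in_itv/= -ler_norml (le_trans (ler_norm_fwd_diff v0 vd i))//.
by rewrite ler_wpMn2l ?(le_trans _ (vd ord0))// ltnW.
Qed.

(** * One nonzero solution with small differences *)

(** The liminf and limsup conditions enter only through two inequalities, one at (T+1) rho and one
    at some t <= rho. *)
Lemma exists_small_solution (R : realType) (T : nat) (p : 'I_T.+2 -> R)
    (F g : R -> R) (lambda rho t : R) :
  (0 < T)%N -> (forall i, 1 < p i) -> 0 < lambda ->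
  (forall x : R, -1 < x < 1 -> is_derive x 1 F (g x)) ->
  (forall x y : R, -1 < x -> x <= y -> y < 1 -> F x <= F y) ->
  F 0 = 0 -> rho *+ T.+1 < 1 ->
  lambda * (F (rho *+ T.+1) *+ T.+2) < rho `^ pmax p / pmax p ->
  0 < t <= rho -> t `^ pmin p *+ T.+1 < lambda * F t ->
  exists u : {ffun 'I_T.+2 -> R},
    [/\ is_solution p g lambda u, u != 0 & forall k, `|fwd_diff u k| <= rho].
Proof.
move=> T0 p1 l0 dF mF F0 c1 Fc /andP[t0 tr] Ft.
have r0 : 0 < rho := lt_le_trans t0 tr.
have r1 : rho <= 1.
  by rewrite (le_trans _ (ltW c1))// -[leLHS]mulr1n ler_wpMn2l// ltW.
pose K : set 'rV[R]_T.+2 := [set v | [/\ v ord0 ord0 = 0, v ord0 ord_max = 0 &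
    forall k, `|fwd_diff (v ord0) k| <= rho]].
pose J (v : 'rV[R]_T.+2) := energy p F lambda (v ord0).
have Kle v i : K v -> `|v ord0 i| <= rho *+ T.+1.
  move=> [v0 _ vd]; rewrite (le_trans (ler_norm_fwd_diff v0 vd i))//.
  by rewrite ler_wpMn2l ?(ltW r0)// -ltnS ltn_ord.
pose w : 'rV[R]_T.+2 :=
  \row_i (if (i == ord0) || (i == ord_max) then 0 else t).
have wE : w ord0 = (fun i => if (i == ord0) || (i == ord_max) then 0 else t).
  by apply/funext => i; rewrite mxE.
have Kw : K w.
  split; rewrite wE ?eqxx ?orbT// => k.
  rewrite /fwd_diff; do 2 case: ifP => _;
    by rewrite ?subr0 ?sub0r ?subrr ?normrN ?normr0 ?(ltW r0) ?(gtr0_norm t0).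
have Jw : J w < 0.
  by rewrite /J wE energy_plateau_lt0// t0 (le_trans tr).
have cJ : {within K, continuous J}.
  apply: continuous_in_subspaceT => v /set_mem Kv.
  apply: continuous_energy => // i.
  apply/differentiable_continuous/derivable1_diffP.
  by apply: ex_derive; apply: dF; rewrite -ltr_norml (le_lt_trans (Kle _ _ Kv)).
have [v /set_mem Kv vmin] := EVT_min_rV (ex_intro _ w Kw)
  (@compact_fwd_diff_le R T rho) cJ.
have Jv : J v < 0 by rewrite (le_lt_trans _ Jw)// vmin// inE.
have [v0 vT vd] := Kv.
have vlt k : `|fwd_diff (v ord0) k| < rho.
  rewrite lt_neqAle vd andbT; apply/eqP => vk.
  have := energy_boundary_gt0 p1 l0 r0 c1 mF Fc v0 vd vk.
  by rewrite ltNge (ltW Jv).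
(* The first slack keeps perturbed values inside ]-1, 1[, where [F] is differentiable; the second
   keeps every difference within rho, since a bump of height s changes each by at most |s|. *)
pose delta := Num.min (1 - rho *+ T.+1)
  (\big[Num.min/rho]_(k < T.+1) (rho - `|fwd_diff (v ord0) k|)).
have d0 : 0 < delta.
  rewrite lt_min subr_gt0 c1/=; apply: lt_bigmin => // k _.
  by rewrite subr_gt0.
have d1 : delta <= 1 - rho *+ T.+1 by rewrite ge_min lexx.
have d2 k : delta <= rho - `|fwd_diff (v ord0) k|.
  by rewrite ge_min bigmin_le ?orbT.
exists (finfun (v ord0)).
have -> : (finfun (v ord0) : _ -> _) = v ord0.
  by apply/funext => i; rewrite ffunE.
split => //.
  apply: (critical_is_solution p1 d0 v0 vT) => [i s sd|j s sd].
    apply: dF; rewrite -ltr_norml (le_lt_trans (ler_normD _ _))//.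
    by rewrite -(subrKC (rho *+ T.+1) 1) ler_ltD ?Kle// (lt_le_trans sd).
  pose v' : 'rV[R]_T.+2 := \row_i (v ord0 i + s * (i == interior_node j)%:R).
  have v'E : v' ord0 = (fun i => v ord0 i + s * (i == interior_node j)%:R).
    by apply/funext => i; rewrite mxE.
  rewrite -v'E; apply: (vmin v'); rewrite inE; split; rewrite v'E.
  - by rewrite v0 add0r mulr0.
  (* The right end is not an interior node: equality would force j = T. *)
  - rewrite vT add0r; case: eqP => [/(congr1 val)/= |_]; last by rewrite mulr0.
    by rewrite /bump add1n => -[] jT; have := ltn_ord j; rewrite -jT ltnn.
  - move=> k; rewrite fwd_diffD fwd_diffZ (le_trans (ler_normD _ _))//.
    rewrite -lerBrDl (le_trans _ (d2 k))// (le_trans _ (ltW sd))// normrM.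
    rewrite ler_piMr// fwd_diff_interior_node.
    by do 2 case: (_ == _); rewrite ?subrr ?subr0 ?sub0r ?normrN ?normr1 ?normr0.
(* The zero function has energy 0, whereas the minimiser has negative energy. *)
apply/eqP => /ffunP vz; move: Jv; rewrite /J.
have -> : v ord0 = fun=> 0.
  by apply/funext => i; have := vz i; rewrite !ffunE.
rewrite /energy (eq_bigr (fun=> 0)) => [|k _]; last first.
  by rewrite /fwd_diff subrr normr0 powR0 ?mul0r// gt_eqF// (lt_trans _ (p1 _)).
by rewrite F0 !big1_eq mulr0 subrr ltxx.
Qed.

(** * From liminf and limsup to a sequence of solutions *)

(** The liminf is the supremum over members of the filter of the infimum of [f], so the infimum over
    [V] is also below [a]. *)
Lemma limf_einf_lt (R : realType) (f : R -> \bar R) (A : set_system R)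
    (a : \bar R) (V : set R) :
  (limf_einf f A < a)%E -> A V -> exists2 x, V x & (f x < a)%E.
Proof.
rewrite limf_einfE => fa AV.
have /ereal_inf_lt[_ [x Vx <-] fxa] : (ereal_inf [set f x | x in V] < a)%E.
  by apply: le_lt_trans fa; apply: ereal_sup_ubound; exists V.
by exists x.
Qed.

Lemma limf_esup_gt (R : realType) (f : R -> \bar R) (A : set_system R)
    (a : \bar R) (V : set R) :
  (a < limf_esup f A)%E -> A V -> exists2 x, V x & (a < f x)%E.
Proof.
move=> fa AV.
have /ereal_sup_gt[_ [x Vx <-] fxa] : (a < ereal_sup [set f x | x in V])%E.
  by apply: (lt_le_trans fa); apply: ereal_inf_lbound; exists V.
by exists x.
Qed.

Lemma nbhs_right0_itv (R : realType) (d : R) : 0 < d -> 0^'+ `]0, d[%classic.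
Proof.
by move=> d0; near=> x; rewrite /= in_itv/=; apply/andP; split; near: x;
  [exact: nbhs_right_gt|exact: nbhs_right_lt].
Unshelve. all: end_near. Qed.

Theorem theorem1p1 (R : realType) (T : nat) (p : 'I_T.+2 -> R) (g : R -> R) :
  (2 <= T)%N ->
  1 < pmin p ->
  1 < pmax p ->
  (forall x : R, 0 <= g x) ->
  continuous g ->
  limf_einf (fun t : R => (primitive0 g t / t `^ pmax p)%:E) 0^'+ = 0%E ->
  limf_esup (fun t : R => (primitive0 g t / t `^ pmin p)%:E) 0^'+ = +oo%E ->
  forall lambda : R, 0 < lambda ->
  exists u : nat -> {ffun 'I_T.+2 -> R},
    [/\ forall n : nat, is_solution p g lambda (u n),
        forall n : nat, u n != 0 &
        Hnorm (u n) @[n --> \oo] --> (0 : R)].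
Proof.
move=> T2 pm1 pM1 g0 cg infG supG lambda l0.
have p1 i : 1 < p i by rewrite (lt_le_trans pm1)// pmin_le.
have pM0 : 0 < pmax p := lt_trans ltr01 pM1.
have [F [dF mF FE]] := ge0_local_primitive g0 cg.
have F0 : F 0 = 0.
  by rewrite FE ?lexx ?ltr01// /primitive0 set_itv1 Rintegral_set1.
have small (d : R) : 0 < d -> exists u : {ffun 'I_T.+2 -> R},
    [/\ is_solution p g lambda u, u != 0 & Hnorm u <= d].
  move=> d0.
  (* Chosen so that lambda (T+2) e c^(p+) equals rho^(p+) / p+ when rho = c / (T+1). *)
  pose e := (lambda * T.+2%:R * (T.+1%:R `^ pmax p) * pmax p)^-1.
  have e0 : 0 < e by rewrite invr_gt0 !mulr_gt0// powR_gt0.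
  (* Below d, c bounds the norm as required; below 1, it stays in the domain of [F]. *)
  have m0 : 0 < Num.min d 1 by rewrite lt_min d0/=.
  have : (0 < e%:E)%E by rewrite lte_fin.
  rewrite -infG => /limf_einf_lt/(_ (nbhs_right0_itv m0))[c].
  rewrite /= in_itv/= lte_fin lt_min => /andP[c0 /andP[cd c1]].
  rewrite -FE ?(ltW c0)// ltr_pdivrMr ?powR_gt0// => Fc.
  pose rho := c / T.+1%:R.
  have r0 : 0 < rho by rewrite divr_gt0.
  have rc : rho *+ T.+1 = c by rewrite -mulr_natr divfK// pnatr_eq0.
  (* A quotient exceeding (T+1) / lambda is exactly the plateau condition; t is sought in ]0,
     rho[. *)
  have := ltry (T.+1%:R / lambda).
  rewrite -supG => /limf_esup_gt/(_ (nbhs_right0_itv r0))[t].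
  rewrite /= in_itv/= lte_fin => /andP[t0 tr].
  have tc : t < 1.
    by rewrite (lt_trans tr)// (le_lt_trans _ c1)// ler_pdivrMr// ler_peMr ?ler1n// ltW.
  rewrite -FE ?(ltW t0)// ltr_pdivlMr ?powR_gt0// => Ft.
  have [||||u [us u0 ud]] := @exists_small_solution R T p F g lambda rho t
    (ltnW T2) p1 l0 dF mF F0.
  - by rewrite rc.
  - rewrite rc; apply: (@lt_le_trans _ _ (lambda * (e * c `^ pmax p *+ T.+2))).
      by rewrite ltr_pM2l// ltr_pMn2r.
    rewrite le_eqVlt; apply/orP; left; apply/eqP.
    have X0 : T.+1%:R `^ pmax p != 0 :> R by rewrite gt_eqF// powR_gt0.
    rewrite /rho powRM ?invr_ge0 ?(ltW c0)//.
    rewrite -(powR_inv1 (ler0n _ _)) -powRrM mulN1r powRN.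
    rewrite /e -mulr_natr; field.
    by rewrite X0 !gt_eqF//= ltr0Sn.
  - by rewrite t0 ltW.
  - rewrite -mulr_natl -ltr_pdivrMl//.
    by move: Ft; rewrite mulrAC mulrC.
  exists u; split => //.
  by rewrite (le_trans (Hnorm_le (ltW r0) ud))// rc ltW.
have d0 n : 0 < (n.+1%:R : R)^-1 by rewrite invr_gt0.
have [u Hu] := choice (fun n => small _ (d0 n)).
exists u; split => [n|n|]; [by have [] := Hu n|by have [] := Hu n|].
(* The n-th solution was chosen with norm at most 1 / (n + 1). *)
apply: (@squeeze_cvgr _ _ _ _ (fun=> 0) (fun n => n.+1%:R^-1)).
- by apply: nearW => n; rewrite sqrtr_ge0; have [] := Hu n.
- exact: cvg_cst.
- exact: cvg_harmonic.
Qed.
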